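(* Let $0<p\leq1$, let $(\mathcal{M},d,0)$ be a pointed $p$-metric space, and let $\mathcal{N}\subseteq\mathcal{M}$ be a Lipschitz retract of $\mathcal{M}$ with $0\in\mathcal{N}$. Then $$\mathcal{F}_{p}(\mathcal{M})\simeq\mathcal{F}_{p}(\mathcal{N})\oplus\mathcal{F}_{p}(\mathcal{M}/\mathcal{N}).$$
   Context: Let $0<p\le 1$. A $p$-metric on a set $\mathcal{M}$ is a symmetric map $d\colon\mathcal{M}\times\mathcal{M}\to[0,\infty)$ with $d(x,y)=0$ iff $x=y$ and $d^p(x,y)\le d^p(x,z)+d^p(z,y)$ for all $x,y,z$. A $p$-Banach space is a complete real vector space with a $p$-norm, i.e. a quasi-norm with $\|x+y\|^p\le\|x\|^p+\|y\|^p$. For a $p$-metric space $\mathcal{M}$ with base point $0$, the Lipschitz free $p$-space $\mathcal{F}_p(\mathcal{M})$ is the $p$-Banach space, unique up to linear isometry, with an isometric embedding $\delta_{\mathcal{M}}\colon\mathcal{M}\to\mathcal{F}_p(\mathcal{M})$, $\delta_{\mathcal{M}}(0)=0$, such that for every $p$-Banach space $X$ and every Lipschitz map $f\colon\mathcal{M}\to X$ with $f(0)=0$ there is a unique bounded linear map $T_f\colon\mathcal{F}_p(\mathcal{M})\to X$ with $T_f\circ\delta_{\mathcal{M}}=f$, and $\|T_f\|=\mathrm{Lip}(f)$. The linear span of $\delta_{\mathcal{M}}(\mathcal{M})$ is dense in $\mathcal{F}_p(\mathcal{M})$. $\mathcal{N}\subseteq\mathcal{M}$ is a Lipschitz retract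 if there is a Lipschitz map $r\colon\mathcal{M}\to\mathcal{M}$ with $r(\mathcal{M})=\mathcal{N}$ and $r(x)=x$ for $x\in\mathcal{N}$ (such $\mathcal{N}$ is closed). For closed $\mathcal{N}\subseteq\mathcal{M}$ with $0\in\mathcal{N}$, the quotient $\mathcal{M}/\mathcal{N}$ is the pointed $p$-metric space with underlying set $(\mathcal{M}\setminus\mathcal{N})\cup\{0\}$, base point $0$, and $p$-metric $d_{\mathcal{M}/\mathcal{N}}(x,y)=\min\{d(x,y),(d^p(x,\mathcal{N})+d^p(y,\mathcal{N}))^{1/p}\}$. $\simeq$ denotes linear isomorphism. *)

(* Defs.v *)
From HB Require Import structures.
From mathcomp Require Import all_boot all_order all_algebra.
From mathcomp Require Import all_classical all_reals all_analysis.
From mathcomp Require Import ring lra.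

Set Implicit Arguments.
Unset Strict Implicit.
Unset Printing Implicit Defensive.

Import Order.TTheory GRing.Theory Num.Theory.

Local Open Scope classical_set_scope.
Local Open Scope ring_scope.

(* The condition [0 < p <= 1] is not a field of the structures below: it is an
   explicit hypothesis of the constructions and results that need it. *)

Record pMetricSpace (R : realType) (p : R) := PMetricSpace {
  pm_car :> Type;
  pdist : pm_car -> pm_car -> R;
  pdist_ge0 : forall x y, 0 <= pdist x y;
  pdist_eq0 : forall x y, pdist x y = 0 <-> x = y;
  pdistC : forall x y, pdist x y = pdist y x;
  pdist_triangle : forall x y z,
    pdist x y `^ p <= pdist x z `^ p + pdist z y `^ p
}.

(* The normed modules of MathComp-Analysis satisfy the triangle inequality for
   the norm itself, so they do not cover the case [p < 1]. *)
Record pBanachSpace (R : realType) (p : R) := PBanachSpace {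
  pb_car :> lmodType R;
  pnorm : pb_car -> R;
  pnorm_ge0 : forall x, 0 <= pnorm x;
  pnorm_eq0 : forall x, pnorm x = 0 -> x = 0;
  pnormZ : forall (a : R) x, pnorm (a *: x) = `|a| * pnorm x;
  pnormD : forall x y, pnorm (x + y) `^ p <= pnorm x `^ p + pnorm y `^ p;
  pnorm_complete : forall u : nat -> pb_car,
    (forall e : R, 0 < e -> exists n0 : nat, forall m n : nat,
       (n0 <= m)%N -> (n0 <= n)%N -> pnorm (u m - u n) < e) ->
    exists l : pb_car, forall e : R, 0 < e -> exists n0 : nat, forall n : nat,
       (n0 <= n)%N -> pnorm (u n - l) < e
}.

Lemma ler_powR_base (R : realType) (p : R) : 0 <= p ->
  forall a b : R, 0 <= a -> a <= b -> a `^ p <= b `^ p.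
Proof.
move=> p0 a b a0 ab; apply: ge0_ler_powR => //; rewrite nnegrE//.
exact: le_trans ab.
Qed.

Section PMetricOfPBanach.
Variables (R : realType) (p : R) (X : pBanachSpace p).
Implicit Types x y z : X.

Definition pnorm_dist x y : R := pnorm (x - y).

Lemma pnorm_dist_eq0 x y : pnorm_dist x y = 0 <-> x = y.
Proof.
rewrite /pnorm_dist; split=> [/pnorm_eq0/eqP|->].
  by rewrite subr_eq0 => /eqP.
by have := pnormZ 0 (y - y); rewrite scale0r normr0 mul0r subrr.
Qed.

Lemma pnorm_distC x y : pnorm_dist x y = pnorm_dist y x.
Proof. by rewrite /pnorm_dist -(opprB y x) -(scaleN1r (y - x)) pnormZ normrN1 mul1r. Qed.

Lemma pnorm_dist_triangle x y z :
  pnorm_dist x y `^ p <= pnorm_dist x z `^ p + pnorm_dist z y `^ p.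
Proof.
have -> : pnorm_dist x y = pnorm ((x - z) + (z - y)) by rewrite subrKA.
exact: pnormD.
Qed.

Definition pmetric_of : pMetricSpace p :=
  PMetricSpace (fun x y => pnorm_ge0 (x - y) : 0 <= pnorm_dist x y)
    pnorm_dist_eq0 pnorm_distC pnorm_dist_triangle.

End PMetricOfPBanach.

Section Lipschitz.
Variables (R : realType) (p : R) (M M' : pMetricSpace p).

Definition is_lipschitz (f : M -> M') : Prop :=
  exists L : R, forall x y, pdist (f x) (f y) <= L * pdist x y.

(* [sup] is [0] on the empty set, so [lip f = 0] when [M] is a point. *)
Definition lip (f : M -> M') : R :=
  sup [set pdist (f xy.1) (f xy.2) / pdist xy.1 xy.2
      | xy in [set xy : M * M | xy.1 <> xy.2]].

End Lipschitz.

Section LinearMaps.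
Variables (R : realType) (p : R) (X Y : pBanachSpace p).

Definition is_bounded (T : X -> Y) : Prop :=
  exists C : R, forall x, pnorm (T x) <= C * pnorm x.

Definition opnorm (T : X -> Y) : R :=
  sup [set pnorm (T x) | x in [set x : X | pnorm x <= 1]].

End LinearMaps.

Definition isomorphic (R : realType) (p : R) (X Y : pBanachSpace p) : Prop :=
  exists (T : {linear X -> Y}) (S : {linear Y -> X}),
    [/\ is_bounded T, is_bounded S, cancel T S & cancel S T].

Section DirectSum.
Variables (R : realType) (p : R) (hp : 0 < p <= 1) (X Y : pBanachSpace p).
Implicit Types z t : (X * Y)%type.

(* The max norm is equivalent to the l^q-sums of the two p-norms, so the choice
   does not matter up to linear isomorphism. *)
Definition sum_norm z : R := Num.max (pnorm z.1) (pnorm z.2).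

Lemma sum_norm_ge0 z : 0 <= sum_norm z.
Proof. by rewrite le_max pnorm_ge0. Qed.

Lemma sum_norm_eq0 z : sum_norm z = 0 -> z = 0.
Proof.
case: z => x y /eqP; rewrite eq_le ge_max /= => /andP[/andP[x0 y0] _].
by congr pair; apply: pnorm_eq0; apply/eqP; rewrite eq_le pnorm_ge0 ?x0 ?y0.
Qed.

Lemma sum_normZ (a : R) z : sum_norm (a *: z) = `|a| * sum_norm z.
Proof. by rewrite /sum_norm !pnormZ maxr_pMr. Qed.

Lemma sum_normD z t :
  sum_norm (z + t) `^ p <= sum_norm z `^ p + sum_norm t `^ p.
Proof.
have p0 : 0 <= p by case/andP: hp => /ltW.
rewrite {1}/sum_norm; case: (leP (pnorm (z + t).1) (pnorm (z + t).2)) => _;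
  apply: (le_trans (pnormD _ _)); apply: lerD; apply: ler_powR_base => //;
  by rewrite ?pnorm_ge0// le_max lexx ?orbT.
Qed.

Lemma sum_norm_complete (u : nat -> (X * Y)%type) :
  (forall e : R, 0 < e -> exists n0 : nat, forall m n : nat,
     (n0 <= m)%N -> (n0 <= n)%N -> sum_norm (u m - u n) < e) ->
  exists l, forall e : R, 0 < e -> exists n0 : nat, forall n : nat,
     (n0 <= n)%N -> sum_norm (u n - l) < e.
Proof.
move=> cu.
have [|l1 ul1] := @pnorm_complete _ _ X (fun n => (u n).1).
  move=> e /cu[n0 H]; exists n0 => m n hm hn.
  by have := H _ _ hm hn; rewrite gt_max => /andP[].
have [|l2 ul2] := @pnorm_complete _ _ Y (fun n => (u n).2).
  move=> e /cu[n0 H]; exists n0 => m n hm hn.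
  by have := H _ _ hm hn; rewrite gt_max => /andP[].
exists (l1, l2) => e e0; have [n1 H1] := ul1 _ e0; have [n2 H2] := ul2 _ e0.
exists (maxn n1 n2) => n; rewrite geq_max => /andP[h1 h2].
by rewrite gt_max H1 ?H2.
Qed.

Definition direct_sum : pBanachSpace p :=
  @PBanachSpace R p (X * Y)%type sum_norm sum_norm_ge0 sum_norm_eq0
    sum_normZ sum_normD sum_norm_complete.

End DirectSum.

(* [F] with the map [delta] is a Lipschitz free p-space over the p-metric space
   [M] with base point [o]. *)
Record is_lipschitz_free (R : realType) (p : R) (M : pMetricSpace p) (o : M)
    (F : pBanachSpace p) (delta : M -> F) : Prop := IsLipschitzFree {
  free_isometric : forall x y, pnorm (delta x - delta y) = pdist x y;
  free_base : delta o = 0;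
  free_universal : forall (X : pBanachSpace p) (f : M -> X),
    @is_lipschitz R p M (pmetric_of X) f -> f o = 0 ->
    exists T : {linear F -> X},
      [/\ is_bounded T, forall x, T (delta x) = f x,
          opnorm T = @lip R p M (pmetric_of X) f &
          forall T' : {linear F -> X}, is_bounded T' ->
            (forall x, T' (delta x) = f x) -> T' =1 T]
}.

Section Subspace.
Variables (R : realType) (p : R) (M : pMetricSpace p) (N : set M).

Definition sub_dist (x y : N) : R := pdist (val x) (val y).

Lemma sub_dist_eq0 x y : sub_dist x y = 0 <-> x = y.
Proof. by rewrite /sub_dist pdist_eq0; split=> [/val_inj|->]. Qed.

Definition sub_pmetric : pMetricSpace p :=
  PMetricSpace (fun x y => pdist_ge0 (val x) (val y) : 0 <= sub_dist x y)
    sub_dist_eq0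
    (fun x y => pdistC (val x) (val y))
    (fun x y z => pdist_triangle (val x) (val y) (val z)).

Definition sub_base (o : M) (No : N o) : sub_pmetric := SigSub (mem_set No).

End Subspace.

Definition is_pclosed (R : realType) (p : R) (M : pMetricSpace p)
    (N : set M) : Prop :=
  forall x, (forall e : R, 0 < e -> exists2 y, N y & pdist x y < e) -> N x.

Definition is_lipschitz_retract (R : realType) (p : R) (M : pMetricSpace p)
    (N : set M) : Prop :=
  exists r : M -> M,
    [/\ is_lipschitz r, range r = N & forall x, N x -> r x = x].

Lemma lipschitz_retract_pclosed (R : realType) (p : R) (hp : 0 < p <= 1)
    (M : pMetricSpace p) (N : set M) :
  is_lipschitz_retract N -> is_pclosed N.
Proof.
have /andP[p0 _] := hp.
case=> r [[L rL] rN rid] x xN.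
suff /pdist_eq0 <- : pdist (r x) x = 0 by rewrite -rN; exists x.
set K := Num.max L 0.
have K0 : 0 <= K by rewrite le_max lexx orbT.
have rK y z : pdist (r y) (r z) <= K * pdist y z.
  by rewrite (le_trans (rL y z))// ler_wpM2r ?pdist_ge0// le_max lexx.
have H e : 0 < e -> pdist (r x) x `^ p <= (K `^ p + 1) * e `^ p.
  move=> /[dup] e0 /xN[y Ny xy].
  rewrite (le_trans (pdist_triangle _ _ (r y)))// mulrDl mul1r lerD//.
    rewrite -powRM ?(ltW e0)//.
    apply: ler_powR_base; rewrite ?pdist_ge0 ?(ltW p0)//.
    by rewrite (le_trans (rK _ _))// ler_wpM2l// ltW.
  rewrite rid// pdistC.
  by apply: ler_powR_base; rewrite ?pdist_ge0 ?(ltW p0)// ltW.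
apply/eqP; rewrite eq_le pdist_ge0 andbT leNgt; apply/negP => d0.
have C0 : 0 < K `^ p + 1 by rewrite ltr_wpDl// powR_ge0.
have dp0 : 0 < pdist (r x) x `^ p by exact: powR_gt0.
move: (_ `^ p) dp0 H => D D0 H.
move: (K `^ p + 1) C0 H => C C0 H.
have t0 : 0 < D / (2 * C) by rewrite divr_gt0// mulr_gt0.
have := H ((D / (2 * C)) `^ p^-1) (powR_gt0 _ t0).
rewrite -powRrM mulVf ?gt_eqF// powRr1 ?(ltW t0)//.
have -> : C * (D / (2 * C)) = D / 2 by field; rewrite gt_eqF.
by move=> ?; lra.
Qed.

Section Quotient.
Variables (R : realType) (p : R) (hp : 0 < p <= 1) (M : pMetricSpace p).
Variables (o : M) (N : set M).

Definition dist_set (x : M) : R := inf [set pdist x y | y in N].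

Definition quotient_set : set M := (~` N) `|` [set o].

Definition quotient_dist (x y : quotient_set) : R :=
  Num.min (pdist (val x) (val y))
    ((dist_set (val x) `^ p + dist_set (val y) `^ p) `^ p^-1).

Let p0 : 0 < p. Proof. by case/andP: hp. Qed.

Lemma dist_set_ge0 x : 0 <= dist_set x.
Proof.
rewrite /dist_set; have [->|/set0P N0] := eqVneq [set pdist x y | y in N] set0.
  by rewrite inf0.
by apply: lb_le_inf => // _ [y _ <-]; exact: pdist_ge0.
Qed.

Lemma dist_set_le x y : N y -> dist_set x <= pdist x y.
Proof.
move=> Ny; apply: ge_inf; last by exists y.
by exists 0 => _ [z _ <-]; exact: pdist_ge0.
Qed.

Lemma quotient_distE x y :
  quotient_dist x y `^ p = Num.min (pdist (val x) (val y) `^ p)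
    (dist_set (val x) `^ p + dist_set (val y) `^ p).
Proof.
rewrite /quotient_dist; set a := pdist _ _; set b := _ + _ : R.
have a0 : 0 <= a by exact: pdist_ge0.
have b0 : 0 <= b by rewrite addr_ge0// powR_ge0.
have bE : (b `^ p^-1) `^ p = b by rewrite -powRrM mulVf ?gt_eqF// powRr1.
rewrite -[in RHS]bE; case: (leP a) => ab; symmetry.
  by apply/min_idPl; apply: ler_powR_base => //; exact: ltW.
by apply/min_idPr; apply: ler_powR_base; rewrite ?powR_ge0 ?(ltW p0)// ltW.
Qed.

Lemma quotient_distC x y : quotient_dist x y = quotient_dist y x.
Proof. by rewrite /quotient_dist pdistC addrC. Qed.

Lemma quotient_dist_ge0 x y : 0 <= quotient_dist x y.
Proof. by rewrite le_min pdist_ge0 powR_ge0. Qed.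

Hypotheses (No : N o) (Nc : is_pclosed N).

Lemma dist_set_powRD x z : dist_set x `^ p <= pdist x z `^ p + dist_set z `^ p.
Proof.
rewrite -lerBlDl; set c := _ - _; have [c0|/ltW c0] := leP 0 c; last first.
  by rewrite (le_trans c0)// powR_ge0.
have -> : c = (c `^ p^-1) `^ p by rewrite -powRrM mulVf ?gt_eqF// powRr1.
apply: ler_powR_base; rewrite ?powR_ge0 ?(ltW p0)//.
apply: lb_le_inf; first by exists (pdist z o), o.
move=> _ [y Ny <-].
have -> : pdist z y = (pdist z y `^ p) `^ p^-1.
  by rewrite -powRrM mulfV ?gt_eqF// powRr1 ?pdist_ge0.
apply: ler_powR_base => //; first by rewrite invr_ge0 ltW.
rewrite lerBlDl (le_trans _ (pdist_triangle x y z))//.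
by apply: ler_powR_base; rewrite ?dist_set_ge0 ?dist_set_le ?(ltW p0).
Qed.

Lemma dist_set_eq0 x : dist_set x = 0 -> N x.
Proof.
move=> x0; apply: Nc => e e0.
have [_ [y Ny <-] ye] : exists2 d, [set pdist x y | y in N] d & d < e.
  by apply: inf_lt; [exists (pdist x o), o | rewrite -/(dist_set x) x0].
by exists y.
Qed.

Lemma quotient_dist_eq0 x y : quotient_dist x y = 0 <-> x = y.
Proof.
split=> [d0|->]; last first.
  have yy : pdist (val y) (val y) = 0 by exact/pdist_eq0.
  by rewrite /quotient_dist yy; apply/min_idPl/powR_ge0.
have /eqP : quotient_dist x y `^ p = 0 by rewrite d0 powR0// gt_eqF.
rewrite quotient_distE; case: leP => _ /eqP.
  by move=> /powR_eq0_eq0/pdist_eq0/val_inj.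
move=> /eqP; rewrite paddr_eq0 ?powR_ge0// => /andP[/eqP x0 /eqP y0].
have Nx := dist_set_eq0 (powR_eq0_eq0 x0).
have Ny := dist_set_eq0 (powR_eq0_eq0 y0).
apply: val_inj; have [//|->] := set_valP x.
by have [//|->] := set_valP y.
Qed.

Lemma quotient_dist_triangle x y z : quotient_dist x y `^ p <=
  quotient_dist x z `^ p + quotient_dist z y `^ p.
Proof.
rewrite [leLHS]quotient_distE [X in _ <= X + _]quotient_distE.
rewrite [X in _ <= _ + X]quotient_distE ge_min.
have tri := pdist_triangle (val x) (val y) (val z).
have Dx := dist_set_powRD (val x) (val z).
have Dy := dist_set_powRD (val y) (val z).
rewrite (pdistC (val y)) in Dy.
have Dz := powR_ge0 (dist_set (val z)) p.
case: (leP (pdist (val x) (val z) `^ p)) => _; last first.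
  apply/orP; right; rewrite -addrA lerD2l.
  case: (leP (pdist (val z) (val y) `^ p)) => _; first by rewrite addrC.
  by rewrite addrA ler_wpDl// addr_ge0.
case: (leP (pdist (val z) (val y) `^ p)) => _; first by rewrite tri.
by apply/orP; right; rewrite addrA lerD2r.
Qed.

Definition quotient_pmetric : pMetricSpace p :=
  PMetricSpace quotient_dist_ge0 quotient_dist_eq0 quotient_distC
    quotient_dist_triangle.

Definition quotient_base : quotient_pmetric :=
  SigSub (mem_set (or_intror erefl : quotient_set o)).

End Quotient.

(* Main.v *)
Require Import Defs.
From HB Require Import structures.
From mathcomp Require Import all_boot all_order all_algebra.
From mathcomp Require Import all_classical all_reals all_analysis.

Set Implicit Arguments.
Unset Strict Implicit.
Unset Printing Implicit Defensive.

Import Order.TTheory GRing.Theory Num.Theory.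

Local Open Scope classical_set_scope.
Local Open Scope ring_scope.

(** A retraction [r] onto [N] splits every point of [M] into its image [r x]
    in [N] and its class [q x] in the quotient, where [q] is the identity off
    [N] and collapses [N] to the base point.  Linearizing
      [x |-> (delta (r x), delta (q x))]
    gives [T : FM -> FN (+) FQ].  In the other direction, linearize the
    inclusion of [N] into [M], and the map [x |-> delta x - delta (r x)] on the
    quotient; their sum is [S : FN (+) FQ -> FM].

    The first two maps are Lipschitz because [r] is Lipschitz and [q] is a
    contraction ([quotient_proj_contraction]).  The last one is Lipschitz for
    the quotient distance ([retract_defect_lipschitz]): the shortcut through
    [N] costs at least the distances from its ends to [N], and the distance
    from [x] to [r x] is at most a constant times the distance from [x] to [N]
    ([retract_dist_set]).

    That [S] and [T] are mutually inverse is a computation on the points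
    [delta x], since a bounded linear map out of a free space is determined by
    its values there ([free_ext]). *)

(** * Lipschitz maps in terms of p-th powers *)

Section PowerLipschitz.
Variables (R : realType) (p : R) (hp : 0 < p <= 1).

Let p0 : 0 < p. Proof. by case/andP: hp. Qed.

Lemma ler_powR_cancel (a b : R) : 0 <= a -> 0 <= b ->
  a `^ p <= b `^ p -> a <= b.
Proof.
move=> a0 b0 ab; rewrite leNgt; apply/negP => ba.
suff : b `^ p < a `^ p by rewrite ltNge ab.
by apply: gt0_ltr_powR; rewrite // nnegrE.
Qed.

(** The triangle inequality controls only p-th powers of distances, so Lipschitz
    estimates are proved in that form. *)
Lemma is_lipschitz_powR (A B : pMetricSpace p) (f : A -> B) (C : R) :
  (forall x y, pdist (f x) (f y) `^ p <= C * pdist x y `^ p) ->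
  is_lipschitz f.
Proof.
move=> fC; exists (Num.max C 0 `^ p^-1) => x y.
have C0 : 0 <= Num.max C 0 by rewrite le_max lexx orbT.
apply: ler_powR_cancel; rewrite ?mulr_ge0 ?powR_ge0 ?pdist_ge0//.
rewrite powRM ?powR_ge0 ?pdist_ge0// -powRrM mulVf ?gt_eqF// powRr1//.
by rewrite (le_trans (fC x y))// ler_wpM2r ?powR_ge0// le_max lexx.
Qed.

Lemma is_lipschitz_powR_bound (A B : pMetricSpace p) (f : A -> B) :
  is_lipschitz f -> exists2 C : R, 0 <= C &
    forall x y, pdist (f x) (f y) `^ p <= C * pdist x y `^ p.
Proof.
move=> [L fL]; exists (Num.max L 0 `^ p) => [|x y]; first exact: powR_ge0.
have L0 : 0 <= Num.max L 0 by rewrite le_max lexx orbT.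
rewrite -powRM ?pdist_ge0//.
apply: ler_powR_base; rewrite ?pdist_ge0 ?(ltW p0)//.
by rewrite (le_trans (fL x y))// ler_wpM2r ?pdist_ge0// le_max lexx.
Qed.

End PowerLipschitz.

(** * Bounded linear maps *)

Section BoundedMaps.
Variables (R : realType) (p : R) (hp : 0 < p <= 1).
Implicit Types X Y Z : pBanachSpace p.

Lemma pnorm0 X : pnorm (0 : X) = 0.
Proof. by rewrite -(scale0r 0) pnormZ normr0 mul0r. Qed.

Lemma pnormN X (x : X) : pnorm (- x) = pnorm x.
Proof. by rewrite -scaleN1r pnormZ normrN1 mul1r. Qed.

Lemma is_bounded_ge0 X Y (T : X -> Y) : is_bounded T ->
  exists2 C : R, 0 <= C & forall x, pnorm (T x) <= C * pnorm x.
Proof.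
move=> [C TC]; exists (Num.max C 0) => [|x]; first by rewrite le_max lexx orbT.
by rewrite (le_trans (TC x))// ler_wpM2r ?pnorm_ge0// le_max lexx.
Qed.

Lemma is_bounded_id X : @is_bounded R p X X idfun.
Proof. by exists 1 => x; rewrite mul1r. Qed.

Lemma is_bounded_comp X Y Z (T : Y -> Z) (S : X -> Y) :
  is_bounded T -> is_bounded S -> is_bounded (T \o S).
Proof.
move=> /is_bounded_ge0[C C0 TC] [D SD]; exists (C * D) => x /=.
by rewrite (le_trans (TC _))// -mulrA ler_wpM2l.
Qed.

Lemma is_bounded_add X Y (S T : X -> Y) :
  is_bounded S -> is_bounded T -> is_bounded (fun x => S x + T x).
Proof.
have /andP[p0 _] := hp.
move=> /is_bounded_ge0[C C0 SC] /is_bounded_ge0[D D0 TD].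
exists ((C `^ p + D `^ p) `^ p^-1) => x.
apply: (ler_powR_cancel hp); rewrite ?mulr_ge0 ?powR_ge0 ?pnorm_ge0//.
rewrite powRM ?powR_ge0 ?pnorm_ge0//.
rewrite -powRrM mulVf ?gt_eqF// powRr1 ?addr_ge0 ?powR_ge0//.
rewrite (le_trans (pnormD _ _))// mulrDl -!powRM ?pnorm_ge0//.
by rewrite lerD//; apply: ler_powR_base; rewrite ?pnorm_ge0 ?(ltW p0).
Qed.

Lemma is_bounded_fst X Y : @is_bounded R p (direct_sum hp X Y) X fst.
Proof. by exists 1 => z; rewrite mul1r le_max lexx. Qed.

Lemma is_bounded_snd X Y : @is_bounded R p (direct_sum hp X Y) Y snd.
Proof. by exists 1 => z; rewrite mul1r le_max lexx orbT. Qed.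

End BoundedMaps.

Section DirectSumMaps.
Variables (R : realType) (p : R) (hp : 0 < p <= 1) (X Y Z : pBanachSpace p).

Definition sum_inl (x : X) : direct_sum hp X Y := (x, 0).
Definition sum_inr (y : Y) : direct_sum hp X Y := (0, y).

Lemma sum_inl_linear : linear sum_inl.
Proof. by move=> a u v; congr pair; rewrite /= scaler0 addr0. Qed.

Lemma sum_inr_linear : linear sum_inr.
Proof. by move=> a u v; congr pair; rewrite /= scaler0 addr0. Qed.

HB.instance Definition _ :=
  GRing.isLinear.Build R X (direct_sum hp X Y) _ sum_inl sum_inl_linear.
HB.instance Definition _ :=
  GRing.isLinear.Build R Y (direct_sum hp X Y) _ sum_inr sum_inr_linear.

Lemma is_bounded_inl : is_bounded sum_inl.
Proof.
by exists 1 => x; rewrite mul1r ge_max /= lexx pnorm0 pnorm_ge0.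
Qed.

Lemma is_bounded_inr : is_bounded sum_inr.
Proof.
by exists 1 => y; rewrite mul1r ge_max /= lexx pnorm0 pnorm_ge0.
Qed.

Lemma sum_decomp (z : direct_sum hp X Y) : z = sum_inl z.1 + sum_inr z.2.
Proof. by case: z => x y; congr pair; rewrite /= ?addr0 ?add0r. Qed.

Definition sum_copair (S1 : {linear X -> Z}) (S2 : {linear Y -> Z})
  (z : direct_sum hp X Y) : Z := S1 z.1 + S2 z.2.

Variables (S1 : {linear X -> Z}) (S2 : {linear Y -> Z}).

Lemma sum_copair_linear : linear (sum_copair S1 S2).
Proof.
by move=> a u v; rewrite /sum_copair /= !linearP scalerDr addrACA.
Qed.

HB.instance Definition _ :=
  GRing.isLinear.Build R (direct_sum hp X Y) Z _ (sum_copair S1 S2)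
    sum_copair_linear.

Lemma is_bounded_copair : is_bounded S1 -> is_bounded S2 ->
  is_bounded (sum_copair S1 S2).
Proof.
move=> b1 b2; apply: (@is_bounded_add _ _ hp (direct_sum hp X Y) Z
  (fun z => S1 z.1) (fun z => S2 z.2)).
  exact: is_bounded_comp b1 (is_bounded_fst hp X Y).
exact: is_bounded_comp b2 (is_bounded_snd hp X Y).
Qed.

Lemma sum_copair_inl x : sum_copair S1 S2 (sum_inl x) = S1 x.
Proof. by rewrite /sum_copair /= linear0 addr0. Qed.

Lemma sum_copair_inr y : sum_copair S1 S2 (sum_inr y) = S2 y.
Proof. by rewrite /sum_copair /= linear0 add0r. Qed.

End DirectSumMaps.

Arguments sum_inr {R p} hp X {Y} y.

(** * Maps out of a free space *)

Section FreeSpace.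
Variables (R : realType) (p : R) (M : pMetricSpace p) (o : M).
Variables (F X : pBanachSpace p) (delta : M -> F).
Hypothesis hF : is_lipschitz_free o delta.

Lemma free_extend (f : M -> X) :
  @is_lipschitz R p M (pmetric_of X) f -> f o = 0 ->
  exists2 T : {linear F -> X}, is_bounded T & forall x, T (delta x) = f x.
Proof.
by move=> fL f0; have [T [? ? _ _]] := free_universal hF fL f0; exists T.
Qed.

(** Both maps are the linearization of the Lipschitz map that they induce on
    [M], and that linearization is unique. *)
Lemma free_ext (T T' : {linear F -> X}) : is_bounded T -> is_bounded T' ->
  (forall x, T (delta x) = T' (delta x)) -> T =1 T'.
Proof.
move=> bT bT' TT'.
have fL : @is_lipschitz R p M (pmetric_of X) (T \o delta).
  have [C TC] := bT; exists C => x y.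
  by rewrite -(free_isometric hF) /= /pnorm_dist -linearB.
have f0 : (T \o delta) o = 0 by rewrite /= (free_base hF) linear0.
have [U [_ _ _ uniqU]] := free_universal hF fL f0.
move=> x; rewrite (uniqU T bT)// (uniqU T' bT')// => y.
by rewrite -TT'.
Qed.

End FreeSpace.

Lemma sum_free_ext (R : realType) (p : R) (hp : 0 < p <= 1)
    (A B : pMetricSpace p) (a : A) (b : B) (FA FB X : pBanachSpace p)
    (deltaA : A -> FA) (deltaB : B -> FB)
    (hA : is_lipschitz_free a deltaA) (hB : is_lipschitz_free b deltaB)
    (T T' : {linear direct_sum hp FA FB -> X}) :
  is_bounded T -> is_bounded T' ->
  (forall x, T (sum_inl hp FB (deltaA x)) = T' (sum_inl hp FB (deltaA x))) ->
  (forall y, T (sum_inr hp FA (deltaB y)) = T' (sum_inr hp FA (deltaB y))) ->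
  T =1 T'.
Proof.
move=> bT bT' TA TB z.
have bl := is_bounded_inl hp FA FB; have br := is_bounded_inr hp FA FB.
have eqA := free_ext hA (T := T \o sum_inl hp FB) (T' := T' \o sum_inl hp FB)
  (is_bounded_comp bT bl) (is_bounded_comp bT' bl) TA.
have eqB := free_ext hB (T := T \o sum_inr hp FA) (T' := T' \o sum_inr hp FA)
  (is_bounded_comp bT br) (is_bounded_comp bT' br) TB.
by rewrite [z]sum_decomp !linearD; congr (_ + _); [exact: eqA|exact: eqB].
Qed.

(** * The quotient map and the defect of the retraction *)

Section QuotientMaps.
Variables (R : realType) (p : R) (hp : 0 < p <= 1) (M : pMetricSpace p).
Variables (o : M) (N : set M) (No : N o) (Nc : is_pclosed N).

Let p0 : 0 < p. Proof. by case/andP: hp. Qed.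

Let Q := quotient_pmetric hp No Nc.

Definition quotient_proj (x : M) : Q := insubd (quotient_base hp No Nc) x.

Lemma quotient_proj_in x : N x -> quotient_proj x = quotient_base hp No Nc.
Proof.
move=> Nx; apply: val_inj; rewrite val_insubd; case: ifPn => //.
by rewrite inE => -[].
Qed.

Lemma val_quotient_proj x : ~ N x -> val (quotient_proj x) = x.
Proof.
by move=> nNx; rewrite val_insubd mem_set//; left.
Qed.

Lemma quotient_projK (x : Q) : quotient_proj (val x) = x.
Proof. exact: valKd. Qed.

Lemma dist_set_in x : N x -> dist_set N x = 0.
Proof.
move=> Nx; apply/eqP; rewrite eq_le dist_set_ge0 andbT.
by rewrite (le_trans (dist_set_le x Nx))// (pdist_eq0 x x).2.
Qed.

(** Only the case of a point of [N] and one outside uses the second term of the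
    minimum: the base point of the quotient is at distance [dist_set N x]. *)
Lemma quotient_proj_contraction x y :
  pdist (quotient_proj x) (quotient_proj y) <= pdist x y.
Proof.
have step u v : ~ N u -> N v ->
    pdist (quotient_proj u) (quotient_base hp No Nc) <= pdist u v.
  move=> nNu Nv; apply: (ler_powR_cancel hp); rewrite ?pdist_ge0//.
  rewrite [leLHS]quotient_distE// val_quotient_proj//= (dist_set_in No).
  rewrite powR0 ?gt_eqF// addr0 ge_min; apply/orP; right.
  by apply: ler_powR_base; rewrite ?dist_set_ge0 ?dist_set_le ?(ltW p0).
have [Nx|nNx] := pselect (N x); have [Ny|nNy] := pselect (N y).
- by rewrite !quotient_proj_in// (pdist_eq0 _ _).2 ?pdist_ge0.
- by rewrite (quotient_proj_in Nx) pdistC (pdistC x) step.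
- by rewrite (quotient_proj_in Ny) step.
- by rewrite /pdist/= /quotient_dist !val_quotient_proj// ge_min lexx.
Qed.

Variables (r : M -> M) (C : R).
Hypotheses (C0 : 0 <= C) (rN : forall x, N x -> r x = x)
  (rC : forall x y, pdist (r x) (r y) `^ p <= C * pdist x y `^ p).

(** Compare both [x] and [r x] with an arbitrary point [y = r y] of [N]. *)
Lemma retract_dist_set x :
  pdist x (r x) `^ p <= (1 + C) * dist_set N x `^ p.
Proof.
have C1 : 0 < 1 + C by rewrite ltr_wpDr.
rewrite -ler_pdivrMl//; set c := _ * _.
have c0 : 0 <= c by rewrite mulr_ge0 ?powR_ge0// invr_ge0 ltW.
have cE : c = (c `^ p^-1) `^ p by rewrite -powRrM mulVf ?gt_eqF// powRr1.
rewrite cE; apply: ler_powR_base; rewrite ?powR_ge0 ?(ltW p0)//.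
apply: lb_le_inf => [|_ [y Ny <-]]; first by exists (pdist x o), o.
apply: (ler_powR_cancel hp); rewrite ?powR_ge0 ?pdist_ge0//.
rewrite -cE ler_pdivrMl// mulrDl mul1r.
rewrite (le_trans (pdist_triangle x (r x) y))// lerD2l.
by rewrite -{1}(rN Ny) pdistC.
Qed.

(** The two terms of the quotient distance bound two ways of grouping
    [(delta u - delta (r u)) - (delta v - delta (r v))]: the direct term pairs
    [u] with [v] and [r u] with [r v]; the shortcut through [N] pairs [u] with
    [r u] and [v] with [r v]. *)
Lemma retract_defect_lipschitz (X : pBanachSpace p) (delta : M -> X) :
  (forall x y, pnorm (delta x - delta y) = pdist x y) ->
  @is_lipschitz R p Q (pmetric_of X)
    (fun x => delta (val x) - delta (r (val x))).
Proof.
move=> iso; apply: (is_lipschitz_powR hp (C := 1 + C)) => x y.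
set u := val x; set v := val y.
rewrite [X in _ * X]quotient_distE// minr_pMr ?addr_ge0// le_min.
apply/andP; split.
  rewrite /= /pnorm_dist opprD addrACA -opprD.
  rewrite (le_trans (pnormD _ _))// pnormN !iso mulrDl mul1r lerD2l.
  exact: rC.
rewrite /= /pnorm_dist (le_trans (pnormD _ _))// pnormN !iso.
by rewrite mulrDr lerD ?retract_dist_set.
Qed.

End QuotientMaps.

(** * The isomorphism *)

Theorem theorem1p13 (R : realType) (p : R) (hp : 0 < p <= 1)
    (M : pMetricSpace p) (o : M) (N : set M) (No : N o)
    (hN : is_lipschitz_retract N)
    (FM FN FQ : pBanachSpace p)
    (deltaM : M -> FM) (deltaN : sub_pmetric N -> FN)
    (deltaQ : quotient_pmetric hp No (lipschitz_retract_pclosed hp hN) -> FQ)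
    (hFM : is_lipschitz_free o deltaM)
    (hFN : is_lipschitz_free (sub_base No) deltaN)
    (hFQ : is_lipschitz_free
       (quotient_base hp No (lipschitz_retract_pclosed hp hN)) deltaQ) :
  isomorphic FM (direct_sum hp FN FQ).
Proof.
set Nc := lipschitz_retract_pclosed hp hN in deltaQ hFQ *.
case: (hN) => r [/(is_lipschitz_powR_bound hp)[C C0 rC] rr rN].
have Nr x : N (r x) by rewrite -rr; exists x.
pose q := quotient_proj hp No Nc.
pose rho x : sub_pmetric N := SigSub (mem_set (Nr x)).
have q_in x : N x -> deltaQ (q x) = 0.
  by move=> Nx; rewrite /q quotient_proj_in// (free_base hFQ).
have rho_id (y : sub_pmetric N) : rho (val y) = y.
  by apply: val_inj; exact/rN/set_valP.
have rho_r x : rho (r x) = rho x by apply: val_inj; rewrite /= rN.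
have [||T bT Tdelta] := free_extend hFM (X := direct_sum hp FN FQ)
    (f := fun x => (deltaN (rho x), deltaQ (q x))).
- apply: (is_lipschitz_powR hp (C := Num.max C 1)) => x y.
  rewrite /= /pnorm_dist /= /sum_norm /= (free_isometric hFN).
  rewrite (free_isometric hFQ).
  rewrite {1}maxEle; case: ifP => _; last first.
    by apply: le_trans (rC x y) _; rewrite ler_wpM2r ?powR_ge0// le_max lexx.
  rewrite (@le_trans _ _ (pdist x y `^ p))//.
    apply: ler_powR_base; rewrite ?pdist_ge0//.
      by have /andP[/ltW] := hp.
    exact: quotient_proj_contraction.
  by rewrite ler_peMl ?powR_ge0// le_max lexx orbT.
- rewrite q_in//; congr pair.
  by rewrite -(free_base hFN); congr deltaN; apply: val_inj; exact: rN.
have [||S1 bS1 S1delta] := free_extend hFN (f := fun y => deltaM (val y)).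
- by exists 1 => x y; rewrite mul1r /= /pnorm_dist (free_isometric hFM).
- exact: free_base hFM.
have [||S2 bS2 S2delta] := free_extend hFQ
    (f := fun x => deltaM (val x) - deltaM (r (val x))).
- exact: (retract_defect_lipschitz hp No Nc C0 rN rC (free_isometric hFM)).
- by rewrite /= rN// subrr.
pose S : {linear direct_sum hp FN FQ -> FM} := sum_copair S1 S2.
have bS : is_bounded S by exact: is_bounded_copair.
have Sinl a : S (sum_inl hp FQ a) = S1 a by exact: sum_copair_inl.
have Sinr b : S (sum_inr hp FN b) = S2 b by exact: sum_copair_inr.
exists T, S; split=> //.
- apply: (free_ext hFM (T := S \o T) (T' := idfun)) => [||x /=].
  + exact: is_bounded_comp bS bT.
  + exact: is_bounded_id.
  (* [delta (r x)] plus the defect at [q x], which is [delta x - delta (r x)]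
     off [N] and [0] on [N]. *)
  rewrite Tdelta [X in S X]sum_decomp linearD Sinl Sinr S1delta S2delta /=.
  have [Nx|nNx] := pselect (N x).
    by rewrite /q quotient_proj_in//= !rN// subrr addr0.
  by rewrite val_quotient_proj// addrC subrK.
- apply: (sum_free_ext hFN hFQ (T := T \o S) (T' := idfun)) => [|||].
  + exact: is_bounded_comp bT bS.
  + exact: is_bounded_id.
  + move=> y /=; rewrite Sinl S1delta Tdelta rho_id q_in//.
    exact: set_valP.
  (* [x] and [r x] have the same retract, so the first coordinate of
     [T (delta x - delta (r x))] cancels. *)
  + move=> x /=; rewrite Sinr S2delta linearB !Tdelta rho_r (q_in (r _))//.
    by rewrite /q quotient_projK; congr pair; rewrite /= ?subrr ?subr0.
Qed.
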